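(* Fix $0<c<1$. Let $m=cn$ and let $\pi$ be chosen uniformly at random from $\mathrm{PF}(m,n)$. Then, as $n\to\infty$, $$\operatorname{Var}(\pi_1)=\frac1{12}n^2-\frac{c}{6(1-c)}n+o(n),\qquad \operatorname{Cov}(\pi_1,\pi_2)\to-\frac1{4(1-c)^2}.$$
   Context: Write $[n]=\{1,\dots,n\}$. For integers $0\le m\le n$, $\mathrm{PF}(m,n)$ denotes the set of parking functions with $m$ cars and $n$ spots: sequences $(\pi_1,\dots,\pi_m)\in[n]^m$ such that, when cars $1,\dots,m$ enter in order a one-way street with spots $1,\dots,n$ and car $i$ parks in spot $\pi_i$ if it is free and otherwise in the first free spot after $\pi_i$, all cars park. Equivalently, the non-decreasing rearrangement $(\lambda_1,\dots,\lambda_m)$ satisfies $\lambda_i\le n-m+i$ for all $i$. The limit $n\to\infty$ is along integers $n$ with $cn$ an integer; $c$ is fixed. *)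

(* Defs.v *)
From HB Require Import structures.
From mathcomp Require Import all_boot all_order all_algebra archimedean.
From mathcomp Require Import all_classical all_reals all_analysis.

Set Implicit Arguments.
Unset Strict Implicit.
Unset Printing Implicit Defensive.

Import Order.TTheory GRing.Theory Num.Theory.
Import numFieldNormedType.Exports.

Local Open Scope classical_set_scope.

(* The first spot in {p, ..., n} not in the list occ of occupied spots. *)
Definition first_free (n : nat) (occ : seq nat) (p : nat) : option nat :=
  ohead [seq s <- iota p (n.+1 - p) | s \notin occ].

(* Cars with preferences prefs enter in order; occ is the list of spots already
   taken. The result is false as soon as one car fails to park. *)
Fixpoint all_park (n : nat) (occ prefs : seq nat) : bool :=
  if prefs is p :: prefs' then
    if first_free n occ p is Some s then all_park n (s :: occ) prefs' else false
  else true.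

Definition PF (m n : nat) : set (m.-tuple nat) :=
  [set p : m.-tuple nat | all (fun a => 1 <= a <= n) p && all_park n [::] p].
Arguments PF : clear implicits.

Lemma measurable_tuple_nat (m : nat) (A : set (m.-tuple nat)) : measurable A.
Proof.
apply: countable_measurable => [t|]; last exact: countableP.
rewrite [X in measurable X](_ : _ =
  \bigcap_(i in [set: 'I_m])
    ((fun u : m.-tuple nat => tnth u i) @^-1` [set tnth t i])).
  apply: fin_bigcap_measurable => // i _.
  by rewrite -[X in measurable X]setTI; exact: measurable_tnth.
apply/seteqP; split => [u -> //|u tu].
by apply: eq_from_tnth => i; exact: (tu i I).
Qed.

(* The uniform probability on PF m n: the counting measure restricted to PF m n,
   normalized by its total mass #|PF m n|. The Dirac mass is the value of
   mnormalize when this mass is 0, which does not happen for m <= n. *)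
Definition unifPF (R : realType) (m n : nat) : probability (m.-tuple nat) R :=
  mnormalize
    (mrestr (@counting (m.-tuple nat) R) (@measurable_tuple_nat m (PF m n)))
    (dirac (nseq_tuple m 1)).

(* The preference of the (i+1)-st car, as a real random variable. *)
Definition pref (R : realType) (m i : nat) (p : m.-tuple nat) : R :=
  (nth 0 p i)%:R%R.
Arguments pref : clear implicits.

(* Main.v *)
Require Import Defs.
From mathcomp Require Import all_boot all_order all_algebra archimedean.
From mathcomp Require Import all_classical all_reals all_analysis.
From mathcomp Require Import finmap measurable_realfun ring lra zify.

Set Implicit Arguments.
Unset Strict Implicit.
Unset Printing Implicit Defensive.

Import Order.TTheory GRing.Theory Num.Theory.
Import numFieldNormedType.Exports.

Local Open Scope classical_set_scope.
Local Open Scope ring_scope.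

(** Read a preference a as j = n - a: a sequence parks iff, for every i <= n, at
    most i of the cars have j < i.  Fix the N = m - 2 last cars and let
    h i = i - #{cars with j < i}, a walk from 0 whose steps are at most 1.  If u
    is the last zero of h and u + v + 1 the last i with h i = 1, the first two
    cars may have preferences (j, k) iff min j k >= u and max j k >= u + v + 1.
    Cutting the walk at these two points shows that the gaps x = u + 1 and
    d = v + 1 are exchangeable.  With M = n + 1 the number of admissible pairs
    is (M - x)^2 - d^2, so exchangeability gives
    #PF(m, n) / #PF(m - 2, n) = M^2 - 2 M E x, whence E x = M / (M - N), which
    tends to 1 / (1 - c).

    For the centered preference f j = (n - 1) / 2 - j the sums over admissible
    pairs are polynomials in M, x, d.  The leading term of E (f1 f2) is
    E ((x - 1)^2 - d^2) / 4 = (1 - 2 E x) / 4, again by exchangeability, and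
    that of E f1 is - (E x - 1) / 2, so the covariance tends to - (E x)^2 / 4.
    The error terms are controlled by E x^4 = O(1), which follows from a
    Chernoff bound for the number of cars with preference in a window of length
    x. *)

(** * The counting polynomials *)

Section TakePoly.
Variable R : comNzRingType.
Implicit Types p q : {poly R}.

Lemma take_poly_mulr k p q : take_poly k (p * take_poly k q) = take_poly k (p * q).
Proof.
apply/polyP => i; rewrite !coef_take_poly; case: ltnP => // ik.
rewrite !coefM; apply: eq_bigr => j _; rewrite coef_take_poly ifT //.
by rewrite (leq_ltn_trans (leq_subr _ _)).
Qed.

Lemma take_poly_mull k p q : take_poly k (take_poly k p * q) = take_poly k (p * q).
Proof. by rewrite mulrC take_poly_mulr mulrC. Qed.

Lemma take_poly_take k l p : take_poly k (take_poly l p) = take_poly (minn k l) p.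
Proof.
by apply/polyP => i; rewrite !coef_take_poly ltn_min; case: ltnP.
Qed.

Lemma take_poly_XnM k l p : (l <= k)%N ->
  take_poly k ('X^l * p) = 'X^l * take_poly (k - l) p.
Proof. by move=> lk; rewrite -commr_polyXn take_polyMXn commr_polyXn. Qed.

Lemma deriv_take_poly k p : (take_poly k p)^`() = take_poly k.-1 p^`().
Proof.
apply/polyP => i; rewrite !(coef_deriv, coef_take_poly).
by case: k => [|k] /=; rewrite ?mul0rn // ltnS; case: ltnP; rewrite ?mul0rn.
Qed.

Lemma take_polySr k p : take_poly k.+1 p = take_poly k p + p`_k *: 'X^k.
Proof.
apply/polyP => i; rewrite !(coefD, coefZ, coef_take_poly, coefXn) ltnS.
by case: ltngtP => [||->]; rewrite ?mulr0 ?mulr1 ?addr0 ?add0r.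
Qed.

End TakePoly.

Definition above (j i : nat) : nat := (j < i)%N.

Section ParkingPoly.
Variables (R : realFieldType) (K : nat).
Implicit Types (b : nat -> nat) (n : nat).

Definition exp_poly : {poly R} := \poly_(i < K.+1) i`!%:R^-1.

(* For n <= K the coefficient of 'X^k is 1 / k! times the number of sequences of
   k values in {0, ..., n - 1} with b i + #{values < i} <= i for all i <= n: the
   exponential series chooses the cars with the largest value, and the truncation
   is the constraint at i = n. *)
Fixpoint park_poly b n : {poly R} :=
  if n is n'.+1 then take_poly (n.+1 - b n) (exp_poly * park_poly b n')
  else take_poly (1 - b 0%N) 1.

Lemma park_poly_ext b b' n : {in leq^~ n, b =1 b'} ->
  park_poly b n = park_poly b' n.
Proof.
elim: n => [|n IH] /= bb'; first by rewrite bb' // unfold_in.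
rewrite (IH (fun i _ => _)) ?bb' ?unfold_in //=.
by move=> i; rewrite unfold_in => ?; rewrite bb' // unfold_in ltnW.
Qed.

Lemma size_park_poly b n : (size (park_poly b n) <= n.+1 - b n)%N.
Proof. by case: n => [|n]; exact: size_take_poly. Qed.

Lemma deriv_exp_poly k : (k <= K)%N ->
  take_poly k exp_poly^`() = take_poly k exp_poly.
Proof.
move=> kK; apply/polyP => i; rewrite !coef_take_poly; case: ltnP => // ik.
have iK := leq_trans ik kK.
rewrite coef_deriv !coef_poly !ltnS iK (ltnW iK) -[LHS]mulr_natr factS natrM.
by field; rewrite nat1r !pnatr_eq0 -!lt0n fact_gt0.
Qed.

(** Differentiating an exponential generating function singles out one car, here of value j. In the
    product rule the derivative of the exponential gives the largest value, and the other term all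
    smaller ones. *)
Lemma deriv_park_poly b n : (n <= K)%N ->
  (park_poly b n)^`() = \sum_(j < n) park_poly (fun i => b i + above j i)%N n.
Proof.
elim: n => [|n IH] nK.
  by rewrite big_ord0 /= deriv_take_poly; apply/polyP => i;
     rewrite coef_take_poly derivC coef0 if_same.
have {}IH := IH (ltnW nK).
rewrite big_ord_recr /= deriv_take_poly derivM take_polyD [LHS]addrC.
have -> : above n n.+1 = 1%N by rewrite /above ltnSn.
rewrite addn1 subnS; set t := (n.+2 - b n.+1).-1.
have tK : (t <= n.+1)%N by rewrite /t; lia.
congr (_ + _).
  rewrite IH mulr_sumr take_poly_sum; apply: eq_bigr => j _.
  have -> : above j n.+1 = 1%N by rewrite /above ltnS ltnW.
  by rewrite addn1 subnS.
rewrite -take_poly_mull deriv_exp_poly ?(leq_trans tK) // take_poly_mull.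
congr (take_poly _ (_ * _)); apply: park_poly_ext => i; rewrite unfold_in => iN.
by rewrite /above ltnNge iN addn0.
Qed.

Local Notation pp := (park_poly (fun=> 0%N)).
Local Notation prim u := (pp u)`_u.

Lemma park_poly0S n : pp n.+1 = take_poly n.+2 (exp_poly * pp n).
Proof. by []. Qed.

(** With fewer than n cars the walk h is positive at n; u is its last zero. Exactly u cars have
    value below u, none has value u, and what follows is a walk of the same kind on n - 1 - u
    values. *)
Lemma renewal n : take_poly n (pp n) = \sum_(u < n) prim u *: ('X^u * pp (n.-1 - u)).
Proof.
elim: n => [|n IH]; first by rewrite big_ord0 take_poly0l.
have ppn : pp n = take_poly n (pp n) + prim n *: 'X^n.
  rewrite -take_polySr take_poly_id //.
  by rewrite (leq_trans (size_park_poly _ _)) // subn0.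
rewrite park_poly0S take_poly_take (minn_idPl (leqnSn _)).
rewrite [in LHS]ppn mulrDr IH take_polyD big_ord_recr /=; congr (_ + _).
  rewrite mulr_sumr take_poly_sum; apply: eq_bigr => u _.
  have un := ltn_ord u.
  rewrite -scalerAr take_polyZ mulrCA take_poly_XnM; last by lia.
  congr (_ *: (_ * _)).
  have -> : (n - u = (n.-1 - u).+1)%N by lia.
  rewrite park_poly0S; congr (take_poly _ _); lia.
rewrite -scalerAr take_polyZ mulrC take_poly_XnM // subSnn subnn.
congr (_ *: (_ * _)).
apply/polyP => i; rewrite !coef_take_poly coef1 coef_poly.
by case: i => //=; rewrite fact0 invr1.
Qed.

(** One more car of value j lowers h by 1 beyond j, so it is admissible iff the last zero u is at
    most j. For n = j + 1 this is [renewal]; a larger n multiplies both sides by the exponential. *)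
Lemma park_poly_above j n : (j < n)%N ->
  park_poly (above j) n = \sum_(u < j.+1) prim u *: ('X^u * pp (n.-1 - u)).
Proof.
elim: n => // n IH; rewrite ltnS leq_eqVlt => /predU1P[<-|jn].
  rewrite -[j.+1]/(j.+1) -renewal /= /above ltnSn subn1 /=.
  rewrite take_poly_take (minn_idPl (leqnSn _)).
  congr (take_poly _ (_ * _)); apply: park_poly_ext => i; rewrite unfold_in => ij.
  by rewrite /above ltnNge ij.
rewrite /= IH // /above ltnS (ltnW jn) subn1 /= mulr_sumr take_poly_sum.
apply: eq_bigr => u _; have uj := ltn_ord u.
rewrite -scalerAr take_polyZ mulrCA take_poly_XnM; last by lia.
congr (_ *: (_ * _)).
have -> : (n - u = (n.-1 - u).+1)%N by lia.
rewrite park_poly0S; congr (take_poly _ _); lia.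
Qed.

(** Past its last zero u, h - 1 is again such a walk, and the second car needs it to be positive
    beyond k: hence a second use of [renewal], with last zero v < k - u. *)
Lemma park_poly_above2 j k n : (j <= k)%N -> (k < n)%N ->
  park_poly (fun i => above j i + above k i)%N n =
  \sum_(u < j.+1) prim u *: ('X^u *
    \sum_(v < k - u) prim v *: ('X^v * pp (n - u.+1 - v.+1))).
Proof.
move=> jk; elim: n => // n IH; rewrite ltnS leq_eqVlt => /predU1P[<-|kn].
  (* For n = k + 1 the second car only lowers the last truncation by one degree. *)
  transitivity (take_poly k (park_poly (above j) k.+1)).
    rewrite /= take_poly_take /above !ltnS leqnn jk; congr (take_poly _ (_ * _)).
      by lia.
    apply: park_poly_ext => i; rewrite unfold_in => ik.
    by rewrite [(k < i)%N]ltnNge ik addn0.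
  rewrite park_poly_above ?ltnS // take_poly_sum; apply: eq_bigr => u _.
  have uj := ltn_ord u.
  rewrite take_polyZ take_poly_XnM; last by lia.
  congr (_ *: (_ * _)); rewrite /= renewal; apply: eq_bigr => v _.
  by congr (_ *: (_ * pp _)); have := ltn_ord v; lia.
have ab : (above j n.+1 + above k n.+1)%N = 2%N.
  by rewrite /above !ltnS (ltnW kn) (leq_trans jk (ltnW kn)).
rewrite [LHS]/= ab IH // mulr_sumr take_poly_sum.
apply: eq_bigr => u _; have uj := ltn_ord u.
rewrite -scalerAr take_polyZ mulrCA take_poly_XnM; last by lia.
congr (_ *: (_ * _)); rewrite mulr_sumr take_poly_sum.
apply: eq_bigr => v _; have vj := ltn_ord v.
rewrite -scalerAr take_polyZ mulrCA take_poly_XnM; last by lia.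
congr (_ *: (_ * _)).
have -> : (n.+1 - u.+1 - v.+1 = (n - u.+1 - v.+1).+1)%N by lia.
rewrite park_poly0S; congr (take_poly _ _); lia.
Qed.

Lemma coef_exp_polyXn n i : (i <= K)%N -> (exp_poly ^+ n)`_i = n%:R ^+ i / i`!%:R.
Proof.
elim: n i => [|n IH] i iK.
  by rewrite expr0 coef1 expr0n; case: i {iK} => [|i] /=; rewrite ?fact0 ?mul0r ?divr1.
rewrite exprS coefM -natr1 exprDn mulr_suml; apply: eq_bigr => j _.
have ji : (j <= i)%N by rewrite -ltnS.
rewrite IH ?(leq_trans (leq_subr _ _)) // coef_poly ltnS (leq_trans ji iK).
rewrite expr1n mulr1 -[X in _ = X / _]mulr_natr -(bin_fact ji) !natrM.
by field; rewrite !pnatr_eq0 -!lt0n !fact_gt0 bin_gt0 ji.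
Qed.

(** Multiplication by the exponential sends the product for n to that for n + 1. The truncation is
    harmless because the coefficient of degree n + 1 of (1 - X) e^((n + 1) X) vanishes. *)
Lemma park_polyE n : (n <= K)%N ->
  pp n = take_poly n.+1 ((1 - 'X) * exp_poly ^+ n.+1).
Proof.
elim: n => [|n IH] nK.
  rewrite [LHS]/= subn0; apply/polyP => i; rewrite !coef_take_poly.
  case: ltnP => //; case: i => // _.
  by rewrite mulrBl mul1r coefB coefXM eqxx subr0 coef_exp_polyXn // coef1 fact0 divr1.
rewrite park_poly0S IH ?(ltnW nK) //.
set q := (1 - 'X) * exp_poly ^+ n.+1.
have q0 : q`_n.+1 = 0.
  rewrite /q mulrBl mul1r coefB coefXM /= !coef_exp_polyXn ?(ltnW nK) //.
  rewrite factS natrM exprS.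
  by field; rewrite ?nat1r !pnatr_eq0 -?lt0n ?fact_gt0.
have -> : take_poly n.+1 q = take_poly n.+2 q.
  by rewrite [RHS]take_polySr q0 scale0r addr0.
by rewrite take_poly_mulr mulrCA -exprS.
Qed.

(** Times i!, this is the classical number (n + 1 - i) (n + 1)^(i - 1) of parking functions; the
    quotient by n + 1 avoids the exponent i - 1 at i = 0. *)
Lemma coef_park_poly n i : (n <= K)%N -> (i <= n)%N ->
  (pp n)`_i = (n.+1%:R - i%:R) * n.+1%:R ^+ i / n.+1%:R / i`!%:R.
Proof.
move=> nK iN; rewrite park_polyE // coef_take_poly ltnS iN mulrBl mul1r coefB coefXM.
rewrite coef_exp_polyXn ?(leq_trans iN) //.
case: i iN => [|i] iN /=.
  by rewrite !subr0 expr0 fact0; field; rewrite nat1r pnatr_eq0.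
rewrite coef_exp_polyXn; last by lia.
rewrite factS natrM exprS.
by field; rewrite ?nat1r !pnatr_eq0 -?lt0n ?fact_gt0.
Qed.

End ParkingPoly.

(** * Parking functions as ballot sequences *)

Section Ballot.
Local Open Scope nat_scope.

(** For a <= n, [n < a + i] says that the value n - a is below i; [b] counts the cars already
    fixed. *)
Definition ballot n (b : nat -> nat) (w : seq nat) : bool :=
  all (fun i => b i + count (fun a => n < a + i) w <= i) (iota 0 n.+1).

Lemma ballotP n b w :
  reflect (forall i, i <= n -> b i + count (fun a => n < a + i) w <= i) (ballot n b w).
Proof.
apply: (iffP allP) => h i.
  by move=> iN; apply: h; rewrite mem_iota /= add0n ltnS.
by rewrite mem_iota /= add0n ltnS; exact: h.
Qed.

Lemma ballot_cons n b a w : a <= n ->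
  ballot n b (a :: w) = ballot n (fun i => b i + above (n - a) i) w.
Proof.
move=> an; apply: eq_all => i /=; rewrite addnA; congr (_ + _ + _ <= _).
by rewrite /above; congr (nat_of_bool _); lia.
Qed.

Lemma ohead_filter_iota (P : pred nat) p k :
  if ohead [seq s <- iota p k | P s] is Some s
  then [/\ p <= s < p + k, P s & forall v, p <= v < s -> ~~ P v]
  else forall v, p <= v < p + k -> ~~ P v.
Proof.
elim: k p => [|k IH] p /=; first by move=> v; lia.
case: ifPn => Pp /=; first by split=> // [|v]; lia.
have := IH p.+1; case: ohead => [s [ps Ps h]|h].
  split=> // [|v]; first by lia.
  by case: (ltngtP p v) => [pv|pv|<-] // vs; apply: h; lia.
move=> v; case: (ltngtP p v) => [pv|pv|<-] // vs; apply: h; lia.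
Qed.

(** A car that prefers p and parks in s may be recorded as s instead of p without changing the
    ballot condition, since the spots from p to s - 1 are taken. Once every car is parked, the spots
    are distinct and the condition is automatic. *)
Lemma all_park_ballot n occ w : uniq occ -> {in occ, forall a, 0 < a <= n} ->
  {in w, forall a, 0 < a <= n} ->
  all_park n occ w = ballot n (fun=> 0) (occ ++ w).
Proof.
elim: w occ => [|p w IH] occ uocc iocc iw.
  apply/esym/ballotP => i iN; rewrite add0n cats0 -size_filter.
  rewrite -[X in _ <= X](size_iota (n.+1 - i) i).
  apply: uniq_leq_size; first exact: filter_uniq.
  by move=> a; rewrite mem_filter mem_iota => /andP[ai /iocc]; lia.
have pn : 0 < p <= n by apply: iw; rewrite mem_head.
have {iw}iw : {in w, forall a, 0 < a <= n} by move=> a aw; apply: iw; rewrite inE aw orbT.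
(* If the spots from p to v - 1 are taken, they and those taken from v = n + 1 - i on all count
   among those taken from p on. *)
have full i v : (forall u, p <= u < v -> u \in occ) -> p <= v -> n.+1 = v + i ->
    (v - p) + count (fun a => n < a + i) occ <= count (fun a => n < a + (n.+1 - p)) occ.
  move=> occ_pv pv iv; rewrite -!size_filter -[X in X + _ <= _](size_iota p).
  rewrite -size_cat; apply: uniq_leq_size.
    rewrite cat_uniq iota_uniq filter_uniq // andbT.
    by apply/hasPn => a; rewrite mem_filter mem_iota; lia.
  move=> a; rewrite mem_cat mem_iota !mem_filter => /orP[ap|/andP[ai ->]].
    by rewrite occ_pv; lia.
  by rewrite andbT; lia.
rewrite /= /first_free.
have := ohead_filter_iota (fun s => s \notin occ) p (n.+1 - p).
case: ohead => [s [psn socc occ_ps]|occ_p].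
  rewrite IH //=; first last.
  - by move=> a; rewrite inE => /predU1P[->|/iocc]; lia.
  - by rewrite socc.
  apply/ballotP/ballotP => h i iN; have := h i iN; rewrite add0n /= !count_cat /=.
    lia.
  (* The two conditions differ only when p <= n - i < s; there the one at n + 1 - p implies the one
     at i. *)
  have [//|nsi] := leqP (n < s + i) (n < p + i); first by lia.
  have := h (n.+1 - p); rewrite add0n /= !count_cat /=.
  have := @full i (n.+1 - i).
  have : count (fun a => n < a + i) w <= count (fun a => n < a + (n.+1 - p)) w.
    by apply: sub_count => a /=; lia.
  move=> hw hf hp.
  have {}hf : n.+1 - i - p + count (fun a => n < a + i) occ <=
     count (fun a => n < a + (n.+1 - p)) occ.
    apply: hf; try lia.
    by move=> u ui; apply/negPn/occ_ps; lia.
  by have {}hp := hp _; lia.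
apply/esym/negP => /ballotP/(_ (n.+1 - p)); rewrite add0n count_cat /=.
have := @full 0 n.+1.
have -> : count (fun a => n < a + 0) occ = 0.
  apply/eqP; rewrite -leqn0 leqNgt -has_count; apply/hasPn => a /iocc; lia.
move=> hf h; have {}hf : n.+1 - p + 0 <= count (fun a => n < a + (n.+1 - p)) occ.
  apply: hf; try lia.
  by move=> u ui; apply/negPn/occ_p; lia.
by have {}h := h _; lia.
Qed.

Fixpoint words n k : seq (k.-tuple nat) :=
  if k is k'.+1 then [seq cons_tuple a w | a <- iota 1 n, w <- words n k']
  else [:: nil_tuple nat].

Lemma mem_words n k (t : k.-tuple nat) :
  (t \in words n k) = all (fun a => 1 <= a <= n) t.
Proof.
elim: k t => [|k IH] t /=; first by rewrite [t]tuple0 inE eqxx.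
case/tupleP: t => a t /=; rewrite -IH.
apply/allpairsP/idP => [[[b w] /= [bn wk e]]|/andP[an tk]].
  have [-> ewt] : a = b /\ t = w.
    by split; [case: (congr1 val e)|apply: val_inj; case: (congr1 val e)].
  by rewrite ewt wk andbT; rewrite mem_iota in bn; lia.
by exists (a, t); split=> //=; rewrite mem_iota; lia.
Qed.

Lemma words_uniq n k : uniq (words n k).
Proof.
elim: k => //= k IH; apply: allpairs_uniq => //; first exact: iota_uniq.
move=> [a w] [b v] _ _ /= /(congr1 val)/= [-> wv].
by congr (_, _); exact: val_inj.
Qed.

End Ballot.

Definition PF_seq m n : seq (m.-tuple nat) :=
  [seq t : m.-tuple nat <- words n m | ballot n (fun=> 0%N) t].

Lemma sum_iota_rev (V : nmodType) n (F : nat -> V) :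
  \sum_(a <- iota 1 n) F (n - a)%N = \sum_(j < n) F j.
Proof.
have -> : iota 1 n = index_iota 1 n.+1 by rewrite /index_iota subn1.
rewrite big_add1 /= big_nat_rev /=.
rewrite big_mkord; apply: eq_bigr => j _; congr F; have := ltn_ord j; lia.
Qed.

Lemma sum_words (V : nmodType) n k (P : pred (seq nat)) (F : seq nat -> V) :
  \sum_(t <- words n k.+1 | P t) F t =
  \sum_(a <- iota 1 n) \sum_(w <- words n k | P (a :: w)) F (a :: w).
Proof.
rewrite big_mkcond big_allpairs_dep /=; apply: eq_bigr => a _.
by rewrite [RHS]big_mkcond.
Qed.

Section Count.
Variables (R : realFieldType) (K : nat).

(** Fixing the value j of the first car adds [above j] to [b], as differentiation does; k
    derivatives produce the k!. *)
Lemma count_ballot n k b : (n <= K)%N ->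
  (count (fun w : k.-tuple nat => ballot n b w) (words n k))%:R
  = k`!%:R * (park_poly R K b n)`_k.
Proof.
move=> nK; elim: k b => [|k IH] b.
  rewrite /= addn0 fact0 mul1r.
  elim: n nK => [|n IHn] nK.
    rewrite /ballot /= coef_take_poly coef1 addn0 andbT subn_gt0 ltnS.
    by case: (b 0 <= 0)%N.
  rewrite /= coef_take_poly subn_gt0 ltnS coef0M coef_poly /= fact0 invr1 mul1r.
  rewrite -IHn ?(ltnW nK) // /ballot -[X in iota 0 X]addn1 iotaD all_cat /=.
  rewrite addn0 andbT andbC add0n.
  by rewrite addn0; case: leqP.
rewrite -sum1_count natr_sum (sum_words _ _ (ballot n b) (fun=> 1)).
transitivity (\sum_(j < n)
   (count (fun w : k.-tuple nat => ballot n (fun i => b i + above j i)%N w) (words n k))%:R : R).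
  rewrite -(sum_iota_rev n (fun j => (count (fun w : k.-tuple nat =>
     ballot n (fun i => b i + above j i)%N w) (words n k))%:R : R)).
  rewrite !big_seq; apply: eq_bigr => a; rewrite mem_iota => an.
  rewrite -sum1_count natr_sum; apply: eq_bigl => w.
  by rewrite ballot_cons //; lia.
under eq_bigr => j _ do rewrite IH.
rewrite -mulr_sumr -coef_sum -deriv_park_poly // coef_deriv factS.
by rewrite natrM -mulr_natl; ring.
Qed.

Lemma park_poly_ge0 n k b : (n <= K)%N -> 0 <= (park_poly R K b n)`_k.
Proof.
move=> nK; have := ler0n R (count (fun w : k.-tuple nat => ballot n b w) (words n k)).
by rewrite (count_ballot k b nK) pmulr_rge0 // ltr0n fact_gt0.
Qed.

Lemma sum_ballot2 (f g : nat -> R) n N : (n <= K)%N ->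
  \sum_(t <- words n N.+2 | ballot n (fun=> 0%N) t)
     f (n - nth 0%N t 0)%N * g (n - nth 0%N t 1)%N =
  N`!%:R * \sum_(j < n) \sum_(k < n) f j * g k *
    (park_poly R K (fun i => above j i + above k i)%N n)`_N.
Proof.
move=> nK.
rewrite (sum_words _ _ (ballot n (fun=> 0%N))
   (fun t => f (n - nth 0%N t 0)%N * g (n - nth 0%N t 1)%N)).
rewrite mulr_sumr -(sum_iota_rev n (fun j => N`!%:R * \sum_(k < n) f j * g k *
    (park_poly R K (fun i => above j i + above k i)%N n)`_N)).
rewrite !big_seq; apply: eq_bigr => a; rewrite mem_iota => an.
rewrite (sum_words _ _ (fun w => ballot n (fun=> 0%N) (a :: w))
   (fun t => f (n - a)%N * g (n - nth 0%N t 0)%N)).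
rewrite mulr_sumr -(sum_iota_rev n (fun k => N`!%:R * (f (n - a)%N * g k *
    (park_poly R K (fun i => above (n - a) i + above k i)%N n)`_N))).
rewrite !big_seq; apply: eq_bigr => a' ; rewrite mem_iota => an' /=.
rewrite mulrCA -count_ballot // -sum1_count natr_sum mulr_sumr.
apply: eq_big => [w|w _]; last by rewrite mulr1.
rewrite !ballot_cons; try lia.
by apply: eq_all => i /=.
Qed.

End Count.

(** * Expectation under the uniform law *)

Lemma PF_seqE m n : PF m n = [set` PF_seq m n].
Proof.
have parkE (t : m.-tuple nat) : t \in words n m ->
    all_park n [::] t = ballot n (fun=> 0%N) t.
  rewrite mem_words => /allP tn.
  by rewrite (all_park_ballot _ _ tn) // => a; rewrite in_nil.
apply/seteqP; split=> t /=; rewrite /PF /= mem_filter -mem_words.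
  by case/andP => tw; rewrite parkE // tw => ->.
by case/andP => tb tw; rewrite parkE // tw tb.
Qed.

Section Uniform.
Variables (R : realType) (m n : nat).
Hypothesis PF_gt0 : (0 < size (PF_seq m n))%N.
Local Notation s := (PF_seq m n).

Lemma mrestr_PF (A : set (m.-tuple nat)) :
  mrestr (@counting (m.-tuple nat) R) (@measurable_tuple_nat m (PF m n)) A =
  (count (fun t => t \in A) s)%:R%:E.
Proof.
rewrite /mrestr PF_seqE /counting asboolT; last exact/finite_setIr/finite_seq.
congr (_%:R%:E).
have -> : A `&` [set` s] = [set` [seq t <- s | t \in A]].
  apply/seteqP; split=> t /=; rewrite [t \in [seq _ <- s | _]]mem_filter.
    by case=> /mem_set -> ->.
  by case/andP => /set_mem.
rewrite -size_filter; apply: perm_size; apply: uniq_perm.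
- exact: fset_uniq.
- by rewrite !filter_uniq // words_uniq.
- by move=> t; rewrite in_fset_set; [rewrite mem_setE|exact: finite_seq].
Qed.

Lemma unifPFE (A : set (m.-tuple nat)) :
  unifPF R m n A = ((count (fun t => t \in A) s)%:R / (size s)%:R)%:E.
Proof.
rewrite /unifPF /= /mnormalize /= mrestr_PF.
have -> : count (fun t => t \in [set: m.-tuple nat]) s = size s.
  by apply/eqP; rewrite -all_count; apply/allP => t _; rewrite in_setT.
rewrite eqe pnatr_eq0 -[_ == 0%N]negbK -lt0n PF_gt0 /=.
by rewrite mrestr_PF EFinM.
Qed.

Lemma expectation_unifPF (X : m.-tuple nat -> R) :
  ('E_(unifPF R m n)[X] = ((\sum_(t <- s) X t) / (size s)%:R)%:E)%E.
Proof.
have mf (D : set (m.-tuple nat)) : measurable_fun D (fun t : m.-tuple nat => (X t)%:E : \bar R).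
  by move=> _ B _; exact: measurable_tuple_nat.
rewrite unlock.
set D := \big[setU/set0]_(t <- s) [set t].
have sD t : (t \in s) -> D t by move=> ts; rewrite /D -bigcup_seq; exists t.
rewrite -(setUv D) integral_setU //; first last.
- by rewrite disj_set2E setICr.
- exact: measurable_tuple_nat.
- exact: measurable_tuple_nat.
have -> : (\int[unifPF R m n]_(t in ~` D) (X t)%:E = 0)%E.
  rewrite (eq_measure_integral mzero) ?integral_measure_zero // => A mA AD.
  apply: etrans (unifPFE A) _; rewrite (_ : count _ _ = 0%N) ?mul0r //.
  apply/eqP; rewrite -leqn0 leqNgt -has_count; apply/hasPn => t /sD Dt.
  by apply/negP => /set_mem/AD.
rewrite adde0.
rewrite integral_bigsetU_EFin //; first last.
- apply/trivIsetP => t u _ _ tu; apply/seteqP; split=> // v [-> /eqP].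
  by rewrite (negbTE tu).
- by rewrite filter_uniq // words_uniq.
- by move=> t; exact: measurable_tuple_nat.
rewrite mulr_suml -sumEFin; apply: eq_big_seq => t ts.
rewrite (eq_integral (cst (X t)%:E)); last by move=> u /set_mem ->.
rewrite integral_cst; last exact: measurable_tuple_nat.
rewrite EFinM; congr (_ * _)%E; apply: etrans (unifPFE [set t]) _.
rewrite (_ : count _ _ = 1%N) ?mul1r //.
rewrite (@eq_count _ _ (pred1 t)) ?count_uniq_mem ?ts //.
  by rewrite filter_uniq // words_uniq.
by move=> u; apply/idP/eqP => [/set_mem //|->]; exact: mem_set.
Qed.

End Uniform.

(** * The two last gaps *)

Section Blocks.
Variables (R : realFieldType) (n N : nat).
Local Notation pp := (park_poly R n (fun=> 0%N)).
Local Notation prim u := (pp u)`_u.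

(** For N + 2 <= n, N! times this is the number of placements of N cars whose walk has its last zero
    at u and its last value 1 at u + v + 1: three independent blocks. The guard prevents a truncated
    n - (u + 1) - (v + 1). *)
Definition block_weight u v : R :=
  if (u + v + 2 <= n)%N then prim u * prim v * ('X^(u + v) * pp (n - u.+1 - v.+1))`_N
  else 0.

Local Notation weight := block_weight.

(** The first two blocks can be exchanged; this is the exchangeability of the gaps. *)
Lemma block_weightC u v : weight u v = weight v u.
Proof.
rewrite /block_weight [(v + u)%N]addnC; case: ifP => // _.
by rewrite mulrAC [prim v * _]mulrC mulrAC -!subnDA [(v.+1 + _)%N]addnC.
Qed.

Lemma coef_park_poly_above2 j k : (j < n)%N -> (k < n)%N ->
  (park_poly R n (fun i => above j i + above k i)%N n)`_N =
  \sum_(u < n) \sum_(v < n)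
    ((u <= minn j k)%N && (u + v < maxn j k)%N)%:R * weight u v.
Proof.
wlog jk : j k / (j <= k)%N => [hw|] jn kn.
  have /orP[jk|kj] := leq_total j k; first exact: hw.
  transitivity (park_poly R n (fun i => above k i + above j i)%N n)`_N.
    rewrite (@park_poly_ext _ _ _ (fun i => above k i + above j i)%N n) // => i _.
    exact: addnC.
  by rewrite hw // minnC maxnC.
rewrite park_poly_above2 // coef_sum (minn_idPl jk) (maxn_idPr jk).
rewrite (big_ord_widen n (fun u => (prim u *:
   ('X^u * \sum_(v < k - u) prim v *: ('X^v * pp (n - u.+1 - v.+1))))`_N)) //.
rewrite big_mkcond; apply: eq_bigr => u _; rewrite ltnS.
case: (leqP u j) => uj /=; last by rewrite big1 // => v _; rewrite mul0r.
rewrite coefZ mulr_sumr coef_sum mulr_sumr.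
rewrite (big_ord_widen n (fun v => prim u *
  ('X^u * (prim v *: ('X^v * pp (n - u.+1 - v.+1))))`_N)); last by lia.
rewrite big_mkcond; apply: eq_bigr => v _.
have -> : (v < k - u)%N = (u + v < k)%N by lia.
case: (ltnP (u + v) k) => uvk; last by rewrite mul0r.
rewrite mul1r /block_weight ifT; last by lia.
by rewrite -scalerAr coefZ mulrA mulrA -exprD.
Qed.

Definition tail_sum (f : nat -> R) y := \sum_(j < n) (y <= j)%N%:R * f j.

Lemma tail_sumE f y : (y <= n)%N ->
  tail_sum f y = \sum_(j < n) f j - \sum_(j < y) f j.
Proof.
move=> yn; rewrite (big_ord_widen n f yn) [X in _ - X]big_mkcond -sumrB.
by apply: eq_bigr => j _; rewrite ltnNge; case: leqP; rewrite ?mul1r ?mul0r ?subr0 ?subrr.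
Qed.

(* A pair of preferences (j, k) is admissible iff both are at least u and not
   both are in the interval between u and u + v + 1. *)
Definition pair_sum f g u v := tail_sum f u * tail_sum g u -
  (tail_sum f u - tail_sum f (u + v).+1) * (tail_sum g u - tail_sum g (u + v).+1).

Lemma pair_sumE f g u v : pair_sum f g u v = \sum_(j < n) \sum_(k < n)
  ((u <= minn j k)%N && (u + v < maxn j k)%N)%:R * (f j * g k).
Proof.
rewrite /pair_sum /tail_sum -!sumrB !big_distrlr /= -sumrB.
apply: eq_bigr => j _; rewrite -sumrB; apply: eq_bigr => k _.
rewrite leq_min leq_max.
have := leq_trans (leq_addr v u) (leqnSn _) => uy.
have [uj|uj] := leqP u j; have [uk|uk] := leqP u k;
have [yj|yj] := ltnP (u + v) j; have [yk|yk] := ltnP (u + v) k => //=; try ring;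
by lia.
Qed.

Lemma sum_pairs (f g : nat -> R) :
  \sum_(j < n) \sum_(k < n) f j * g k *
    (park_poly R n (fun i => above j i + above k i)%N n)`_N =
  \sum_(u < n) \sum_(v < n) weight u v * pair_sum f g u v.
Proof.
transitivity (\sum_(j < n) \sum_(k < n) \sum_(u < n) \sum_(v < n)
   weight u v * (((u <= minn j k)%N && (u + v < maxn j k)%N)%:R * (f j * g k))).
  apply: eq_bigr => j _; apply: eq_bigr => k _.
  rewrite coef_park_poly_above2 // mulr_sumr; apply: eq_bigr => u _.
  by rewrite mulr_sumr; apply: eq_bigr => v _; ring.
under eq_bigr => j _ do rewrite exchange_big.
rewrite exchange_big; apply: eq_bigr => u _.
under eq_bigr => j _ do rewrite exchange_big.
rewrite exchange_big; apply: eq_bigr => v _.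
by rewrite pair_sumE mulr_sumr; apply: eq_bigr => j _; rewrite mulr_sumr.
Qed.

(** Summing over the second cut undoes [renewal] past u; N + 2 <= n keeps the degree N - u below its
    truncation. *)
Lemma sum_block_weight u : (u < n)%N -> (N.+2 <= n)%N ->
  \sum_(v < n) weight u v = prim u * ('X^u * pp (n - u.+1))`_N.
Proof.
move=> un Nn; have [Nu|uN] := ltnP N u.
  rewrite coefXnM Nu mulr0 big1 // => v _; rewrite /block_weight coefXnM ltn_addr //.
  by rewrite mulr0 if_same.
rewrite coefXnM ltnNge uN /=.
have -> : (pp (n - u.+1))`_(N - u) = (take_poly (n - u.+1) (pp (n - u.+1)))`_(N - u).
  by rewrite coef_take_poly ifT //; lia.
rewrite renewal coef_sum mulr_sumr.
rewrite (big_ord_widen n (fun v => prim u *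
  (prim v *: ('X^v * pp ((n - u.+1).-1 - v)))`_(N - u))); last by lia.
rewrite [RHS]big_mkcond; apply: eq_bigr => v _; rewrite /block_weight.
have -> : (v < n - u.+1)%N = (u + v + 2 <= n)%N by lia.
case: leqP => // uvn; rewrite coefZ !coefXnM mulrA.
have -> : ((n - u.+1).-1 - v = n - u.+1 - v.+1)%N by lia.
have -> : (N - u < v)%N = (N < u + v)%N by lia.
by rewrite subnDA.
Qed.

Lemma sum_sum_block_weight : (N.+2 <= n)%N ->
  \sum_(u < n) \sum_(v < n) weight u v = (pp n)`_N.
Proof.
move=> Nn; under eq_bigr => u _ do rewrite sum_block_weight //.
transitivity (take_poly n (pp n))`_N; last by rewrite coef_take_poly ifT //; lia.
rewrite renewal coef_sum; apply: eq_bigr => u _; rewrite coefZ.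
by congr (_ * ('X^_ * pp _)`_N); lia.
Qed.

End Blocks.

(** * Averages over the two gaps *)

Section BlockAverage.
Variables (R : realFieldType) (n N : nat).
Hypothesis Nn : (N.+2 <= n)%N.
Local Notation pp := (park_poly R n (fun=> 0%N)).
Local Notation weight := (block_weight R n N).
Implicit Types F G : R -> R -> R.

Lemma park_poly_gt0 i : (i <= n)%N -> 0 < (pp n)`_i.
Proof.
move=> iN; rewrite coef_park_poly // -natrB ?(leq_trans iN) //.
by rewrite !(divr_gt0, mulr_gt0, exprn_gt0) ?ltr0n ?fact_gt0 ?subn_gt0.
Qed.

Let total_gt0 : 0 < (pp n)`_N.
Proof. by apply: park_poly_gt0; lia. Qed.

Lemma block_weight_ge0 u v : 0 <= weight u v.
Proof.
rewrite /block_weight; case: ifP => // uvn; rewrite coefXnM; case: ifP => _.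
  by rewrite mulr0.
by rewrite !mulr_ge0 // park_poly_ge0 //; lia.
Qed.

(** The expectation of [F] at the gaps x = u + 1 and d = v + 1 when the N last cars are uniform
    among the sequences that park; the denominator is the total weight, by
    [sum_sum_block_weight]. *)
Definition block_mean F : R :=
  (\sum_(u < n) \sum_(v < n) weight u v * F u.+1%:R v.+1%:R) / (pp n)`_N.

Lemma ler_block_mean F G :
  (forall u v, (u + v + 2 <= n)%N -> F u.+1%:R v.+1%:R <= G u.+1%:R v.+1%:R) ->
  block_mean F <= block_mean G.
Proof.
move=> FG; rewrite ler_pM2r ?invr_gt0 //; apply: ler_sum => u _; apply: ler_sum => v _.
have [uv|uv] := leqP (u + v + 2) n; first by rewrite ler_wpM2l ?block_weight_ge0 ?FG.
by rewrite /block_weight leqNgt uv !mul0r.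
Qed.

Lemma eq_block_mean F G :
  (forall u v, (u + v + 2 <= n)%N -> F u.+1%:R v.+1%:R = G u.+1%:R v.+1%:R) ->
  block_mean F = block_mean G.
Proof.
by move=> FG; apply/le_anti; rewrite !ler_block_mean // => u v /FG ->.
Qed.

Lemma block_meanC F : block_mean (fun x d => F d x) = block_mean F.
Proof.
rewrite /block_mean exchange_big; congr (_ / _).
by apply: eq_bigr => u _; apply: eq_bigr => v _; rewrite block_weightC.
Qed.

Lemma block_meanD F G :
  block_mean (fun x d => F x d + G x d) = block_mean F + block_mean G.
Proof.
rewrite /block_mean -mulrDl -big_split; congr (_ / _); apply: eq_bigr => u _.
by rewrite -big_split; apply: eq_bigr => v _; rewrite mulrDr.
Qed.

Lemma block_meanZ a F : block_mean (fun x d => a * F x d) = a * block_mean F.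
Proof.
rewrite /block_mean mulrA mulr_sumr; congr (_ / _); apply: eq_bigr => u _.
by rewrite mulr_sumr; apply: eq_bigr => v _; rewrite mulrCA.
Qed.

Lemma block_mean_cst a : block_mean (fun _ _ => a) = a.
Proof.
rewrite /block_mean.
under eq_bigr => u _ do rewrite -mulr_suml.
by rewrite -mulr_suml sum_sum_block_weight // mulrAC divff ?mul1r // gt_eqF.
Qed.

Lemma ler_norm_block_mean F G :
  (forall u v, (u + v + 2 <= n)%N -> `|F u.+1%:R v.+1%:R| <= G u.+1%:R v.+1%:R) ->
  `|block_mean F| <= block_mean G.
Proof.
move=> FG; rewrite ler_norml; apply/andP; split; last first.
  by apply: ler_block_mean => u v /FG/ler_normlP[].
rewrite -mulN1r -block_meanZ; apply: ler_block_mean => u v /FG.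
by rewrite ler_norml mulN1r => /andP[].
Qed.

Lemma block_mean1 F : block_mean (fun x _ => F x 0) =
  (\sum_(u < n) (pp u)`_u * ('X^u * pp (n - u.+1))`_N * F u.+1%:R 0) / (pp n)`_N.
Proof.
congr (_ / _); apply: eq_bigr => u _.
by rewrite -mulr_suml sum_block_weight.
Qed.

Definition pref_mean (f g : nat -> R) : R :=
  let s := PF_seq N.+2 n in
  (\sum_(t <- s) f (n - nth 0%N t 0)%N * g (n - nth 0%N t 1)%N) / (size s)%:R.

Lemma size_PF_seq :
  (size (PF_seq N.+2 n))%:R
  = (N.+2)`!%:R * (pp n)`_N.+2.
Proof. by rewrite size_filter; apply: count_ballot. Qed.

Lemma size_PF_seq_gt0 :
  (0 < size (PF_seq N.+2 n))%N.
Proof.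
by rewrite -(ltr0n R) size_PF_seq mulr_gt0 ?ltr0n ?fact_gt0 // park_poly_gt0.
Qed.

(** With the N last cars fixed, the sum over the first two is [pair_sum], which sees the others only
    through their gaps. *)
Lemma sum_pref (f g : nat -> R) F :
  (forall u v, (u + v + 2 <= n)%N -> pair_sum n f g u v = F u.+1%:R v.+1%:R) ->
  \sum_(t <- words n N.+2 | ballot n (fun=> 0%N) t)
     f (n - nth 0%N t 0)%N * g (n - nth 0%N t 1)%N
  = N`!%:R * (pp n)`_N * block_mean F.
Proof.
move=> fgF; rewrite (sum_ballot2 f g N (leqnn n)) sum_pairs.
rewrite -mulrA /block_mean [_ * (_ / _)]mulrCA divff ?gt_eqF // mulr1; congr (_ * _).
apply: eq_bigr => u _; apply: eq_bigr => v _.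
have [/fgF -> //|uv] := leqP (u + v + 2) n.
by rewrite /block_weight leqNgt uv !mul0r.
Qed.

Local Notation M := (n.+1%:R : R).
Definition mean_gap : R := M / (M - N%:R).

Lemma tail_sum1 y : (y <= n)%N -> tail_sum n (fun=> 1 : R) y = n%:R - y%:R.
Proof. by move=> yn; rewrite tail_sumE // !sumr_const !card_ord. Qed.

Lemma pair_sum1 u v : (u + v + 2 <= n)%N ->
  pair_sum n (fun=> 1) (fun=> 1) u v = (M - u.+1%:R) ^+ 2 - v.+1%:R ^+ 2.
Proof.
move=> uv; rewrite /pair_sum !tail_sum1 ?(leq_trans _ uv) //; try lia.
by rewrite -!natr1 natrD; ring.
Qed.

(** For f = g = 1, [sum_pref] computes a cardinal known from [coef_park_poly]. As x^2 and d^2 have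
    the same mean, this is a linear equation for the mean of x. *)
Lemma block_mean_gap : block_mean (fun x _ => x) = mean_gap.
Proof.
have MN : M - N%:R != 0 by rewrite subr_eq0 eqr_nat; lia.
have M0 : M != 0 by rewrite pnatr_eq0.
have := @sum_pref _ _ (fun x d => (M - x) ^+ 2 - d ^+ 2) pair_sum1.
under eq_bigr => t _ do rewrite mulr1.
rewrite big_const_seq iter_addr_0 -size_filter size_PF_seq => e.
have {}e : block_mean (fun x d => (M - x) ^+ 2 - d ^+ 2) =
    M ^+ 2 * (M - N%:R - 2) / (M - N%:R).
  have N0 : N`!%:R * (pp n)`_N != 0 by rewrite mulf_neq0 ?gt_eqF // ltr0n fact_gt0.
  apply: (mulfI N0); rewrite -e !coef_park_poly; try lia.
  rewrite !factS !natrM !exprS.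
  have -> : N.+2%:R = N%:R + 2 :> R by rewrite -addn2 natrD.
  have -> : N.+1%:R = N%:R + 1 :> R by rewrite natr1.
  field; rewrite nat1r MN M0 natr1 -natrD addn2 !pnatr_eq0 -?lt0n fact_gt0.
  by [].
have e2 : block_mean (fun x d => (M - x) ^+ 2 - d ^+ 2) =
    M ^+ 2 - 2 * M * block_mean (fun x _ => x).
  rewrite (@eq_block_mean _ (fun x d => M ^+ 2 + (- (2 * M) * x + (x ^+ 2 + -1 * d ^+ 2))));
    last by move=> u v _; ring.
  rewrite !block_meanD block_mean_cst !block_meanZ.
  by rewrite (block_meanC (fun x _ => x ^+ 2)); ring.
have -> : block_mean (fun x _ => x) =
    (M ^+ 2 - M ^+ 2 * (M - N%:R - 2) / (M - N%:R)) / (2 * M).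
  by rewrite -e e2; field; rewrite nat1r M0.
by rewrite /mean_gap; field; rewrite nat1r M0 MN.
Qed.

End BlockAverage.

(** * Sums over admissible pairs *)

Section PairSums.
Variable R : realFieldType.
Implicit Types a M x d : R.

Lemma sum_arith a y : \sum_(j < y) (a - j%:R) = a * y%:R - y%:R * (y%:R - 1) / 2.
Proof.
elim: y => [|y IH]; first by rewrite big_ord0; ring.
by rewrite big_ord_recr /= IH -natr1; field.
Qed.

Definition square_sum a (y : R) : R :=
  a ^+ 2 * y - a * y * (y - 1) + (y - 1) * y * (2 * y - 1) / 6.

Lemma sum_arith_sqr a y : \sum_(j < y) (a - j%:R) ^+ 2 = square_sum a y%:R.
Proof.
rewrite /square_sum; elim: y => [|y IH]; first by rewrite big_ord0; ring.
by rewrite big_ord_recr /= IH -natr1; field.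
Qed.

(* The deviation of a preference n - j from its value (n + 1) / 2 under the
   uniform law on {1, ..., n}. *)
Definition dev n (j : nat) : R := (n%:R - 1) / 2 - j%:R.

Lemma tail_sum_dev n y : (y <= n)%N ->
  tail_sum n (dev n) y = - (y%:R * (n%:R - y%:R) / 2).
Proof. by move=> yn; rewrite tail_sumE // !sum_arith; field. Qed.

Lemma tail_sum_dev2 n y : (y <= n)%N ->
  tail_sum n (fun j => dev n j ^+ 2) y =
  square_sum ((n%:R - 1) / 2) n%:R - square_sum ((n%:R - 1) / 2) y%:R.
Proof. by move=> yn; rewrite tail_sumE // !sum_arith_sqr. Qed.

(** This and the next two are the [pair_sum] of (dev, dev), (dev, 1) and (dev^2, 1) in M = n + 1, x
    = u + 1, d = v + 1. *)
Definition dev_dev M x d : R :=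
  ((x - 1) * (M - x) / 2) ^+ 2 - (d * (M - 2 * x - d + 1) / 2) ^+ 2.
Definition dev_one M x d : R :=
  - ((x - 1) * (M - x) ^+ 2 / 2) - d ^+ 2 * (M - 2 * x - d + 1) / 2.
Definition dev2_one M x d : R := let W := square_sum ((M - 2) / 2) in
  (W (M - 1) - W (x - 1)) * (M - x) - (W (x + d - 1) - W (x - 1)) * d.

(** It bounds an error term monomial by monomial. The common bound is named w so that [lra] can
    treat it as an atom. *)
Lemma monomial_bound M x d (k : nat) : 1 <= M -> 1 <= x -> 1 <= d ->
  exists2 w, M ^+ k * (x + d) ^+ 4 = w &
    forall a i j : nat, (a <= k)%N -> (i + j <= 4)%N ->
      0 <= M ^+ a * x ^+ i * d ^+ j <= w.
Proof.
move=> M1 x1 d1; exists (M ^+ k * (x + d) ^+ 4) => // a i j ak ij.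
have s1 : 1 <= x + d by lra.
have [M0 x0 d0] : [/\ 0 <= M, 0 <= x & 0 <= d] by split; lra.
rewrite !mulr_ge0 ?exprn_ge0 //= -mulrA ler_pM ?mulr_ge0 ?exprn_ge0 //.
  exact: ler_weXn2l.
apply: le_trans (ler_weXn2l s1 ij); rewrite exprD.
by rewrite ler_pM ?exprn_ge0 // lerXn2r ?nnegrE ?addr_ge0 // ?lerDl ?lerDr.
Qed.

Ltac monomial_bounds mb a :=
  let use i j := (have /andP[? ?] := mb a i j isT isT) in
  use 0%N 0%N; use 0%N 1%N; use 0%N 2%N; use 0%N 3%N; use 0%N 4%N;
  use 1%N 0%N; use 1%N 1%N; use 1%N 2%N; use 1%N 3%N;
  use 2%N 0%N; use 2%N 1%N; use 2%N 2%N; use 3%N 0%N; use 3%N 1%N; use 4%N 0%N.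

(** Subtracting the part of degree 2 in M leaves degree at most 1 in M and 4 in (x, d). Here and
    below, 100 generously bounds the sum of the absolute values of the remaining coefficients. *)
Lemma dev_dev_bound M x d : 1 <= M -> 1 <= x -> 1 <= d ->
  `|dev_dev M x d - M ^+ 2 / 4 * ((x - 1) ^+ 2 - d ^+ 2)| <= 100 * (M ^+ 1 * (x + d) ^+ 4).
Proof.
move=> M1 x1 d1; have [w -> mb] := monomial_bound 1 M1 x1 d1.
monomial_bounds mb 0%N. monomial_bounds mb 1%N.
by rewrite /dev_dev ler_norml; apply/andP; split; lra.
Qed.

Lemma dev_one_bound M x d : 1 <= M -> 1 <= x -> 1 <= d ->
  `|dev_one M x d + M ^+ 2 / 2 * (x - 1)| <= 100 * (M ^+ 1 * (x + d) ^+ 4).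
Proof.
move=> M1 x1 d1; have [w -> mb] := monomial_bound 1 M1 x1 d1.
monomial_bounds mb 0%N. monomial_bounds mb 1%N.
by rewrite /dev_one ler_norml; apply/andP; split; lra.
Qed.

Lemma dev2_one_bound M x d : 1 <= M -> 1 <= x -> 1 <= d ->
  `|dev2_one M x d - (M ^+ 4 / 12 - M ^+ 3 / 3 * x)| <= 100 * (M ^+ 2 * (x + d) ^+ 4).
Proof.
move=> M1 x1 d1; have [w -> mb] := monomial_bound 2 M1 x1 d1.
monomial_bounds mb 0%N. monomial_bounds mb 1%N. monomial_bounds mb 2%N.
by rewrite /dev2_one/square_sum /= ler_norml; apply/andP; split; lra.
Qed.

End PairSums.

(** * Tail of the last gap *)

Section Tail.
Variable R : realType.

Lemma binomial_term_le (N u : nat) (a b : R) : (u <= N)%N -> 0 <= a -> 0 <= b ->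
  'C(N, u)%:R * a ^+ u * b ^+ (N - u) <= (a + b) ^+ N.
Proof.
move=> uN a0 b0; rewrite addrC exprDn.
rewrite (bigD1 (Ordinal (uN : (u < N.+1)%N))) //= -[leLHS]addr0 lerD //.
  by rewrite -[leRHS]mulr_natl -mulrA [_ ^+ u * _]mulrC.
by apply: sumr_ge0 => i _; rewrite mulrn_wge0 // mulr_ge0 // exprn_ge0.
Qed.

(* Chernoff's bound for a window of u + 1 out of n + 1 spots, with the optimal
   tilt c^-1. *)
Lemma binomial_window_le (c : R) (n N u : nat) : 0 < c -> c < 1 -> (u <= N)%N ->
  (u <= n)%N -> N%:R <= c * n.+1%:R ->
  'C(N, u)%:R * u.+1%:R ^+ u * (n - u)%:R ^+ (N - u) / n.+1%:R ^+ N <=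
  c ^+ u * expR (1 - c) ^+ u.+1.
Proof.
move=> c0 c1 uN un Nc; set M : R := n.+1%:R; set x : R := u.+1%:R.
have M0 : 0 < M by rewrite ltr0n.
have cu : 0 < c ^+ u by rewrite exprn_gt0.
have := @binomial_term_le N u (c^-1 * x) (n - u)%:R uN _ (ler0n _ _).
rewrite mulr_ge0 ?invr_ge0 ?ler0n ?(ltW c0) // => /(_ isT) h.
rewrite ler_pdivrMr ?exprn_gt0 // -[leRHS]mulrA -ler_pdivrMl //.
rewrite exprMn exprVn in h.
have {h}h : (c ^+ u)^-1 * ('C(N, u)%:R * x ^+ u * (n - u)%:R ^+ (N - u)) <=
    (c^-1 * x + (n - u)%:R) ^+ N.
  by apply: le_trans h; rewrite le_eqVlt; apply/orP; left; apply/eqP; ring.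
apply: (le_trans h).
(* Here n - u = M - x. Then 1 + y <= e^y and N / M <= c leave the exponent (1/c - 1) x c = (1 - c)
   x. *)
have -> : c^-1 * x + (n - u)%:R = M * (1 + (c^-1 - 1) * x / M).
  rewrite natrB // /M /x -!natr1; field.
  by rewrite ?nat1r ?natr1 ?pnatr_eq0 ?gt_eqF.
have t0 : 0 <= (c^-1 - 1) * x / M.
  by rewrite !mulr_ge0 ?invr_ge0 ?ler0n // subr_ge0 invf_ge1 // ltW.
rewrite exprMn mulrC ler_pM2r ?exprn_gt0 //.
apply: (@le_trans _ _ (expR ((c^-1 - 1) * x / M) ^+ N)).
  by rewrite lerXn2r ?nnegrE ?expR_ge0 ?addr_ge0 ?expR_ge1Dx.
rewrite -!expRM_natl ler_expR.
have -> : N%:R * ((c^-1 - 1) * x / M) = (c^-1 - 1) * x * (N%:R / M) by ring.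
have -> : u.+1%:R * (1 - c) = (c^-1 - 1) * x * c.
  by rewrite /x; field; rewrite gt_eqF.
rewrite ler_wpM2l //.
  by rewrite mulr_ge0 ?ler0n // subr_ge0 invf_ge1 // ltW.
by rewrite ler_pdivrMr.
Qed.

Lemma geometric_sum_le (q : R) k : 0 <= q -> q < 1 ->
  \sum_(i < k) q ^+ i.+1 <= (1 - q)^-1.
Proof.
move=> q0 q1; have dq : 0 < 1 - q by rewrite subr_gt0.
apply: (@le_trans _ _ (\sum_(i < k) q ^+ i)).
  by apply: ler_sum => i _; rewrite exprS ler_piMl ?exprn_ge0 // ltW.
rewrite -[leRHS]mul1r ler_pdivlMr // mulrC -opprB mulNr -subrX1 opprB.
by rewrite gerBl exprn_ge0.
Qed.

(** This is 1 + y < e^y at y = c - 1; it makes the window bound decay geometrically. *)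
Lemma lt1_chernoff (c : R) : 0 < c -> c < 1 -> c * expR (1 - c) < 1.
Proof.
move=> c0 c1; have : 1 + (c - 1) < expR (c - 1) by rewrite expR_gt1Dx // subr_eq0 lt_eqF.
rewrite addrC subrK => h.
have e1 : expR (c - 1) * expR (1 - c) = 1.
  by rewrite -expRD addrC addrA subrK subrr expR0.
by rewrite -[ltRHS]e1 ltr_pM2r ?expR_gt0.
Qed.

Lemma sum_pow4_geometric (r : R) : 0 < r -> r < 1 ->
  exists C : R, forall k, \sum_(i < k) i.+1%:R ^+ 4 * r ^+ i.+1 <= C.
Proof.
(* With r = e^(-5a) and x <= e^(ax) / a, four of the five factors e^(-ax) absorb x^4 and the fifth
   is summable. *)
move=> r0 r1; pose a := - ln r / 5.
have a0 : 0 < a by rewrite divr_gt0 // oppr_gt0 ln_lt0 // r0.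
have rE : r = expR (- a) ^+ 5.
  by rewrite -expRM_natl /a mulrN mulrC divfK // opprK lnK.
have q1 : expR (- a) < 1 by rewrite expR_lt1 oppr_lt0.
exists (a ^- 4 / (1 - expR (- a))) => k.
apply: (@le_trans _ _ (a ^- 4 * \sum_(i < k) expR (- a) ^+ i.+1)); last first.
  by rewrite ler_pM2l ?invr_gt0 ?exprn_gt0 // geometric_sum_le // expR_ge0.
rewrite mulr_sumr; apply: ler_sum => i _; set x : R := i.+1%:R.
have x0 : 0 <= x by rewrite ler0n.
have axe : x <= a^-1 * expR (a * x).
  rewrite -ler_pdivrMl ?invr_gt0 // invrK.
  by apply: le_trans (expR_ge1Dx _); rewrite lerDr.
apply: (@le_trans _ _ ((a^-1 * expR (a * x)) ^+ 4 * r ^+ i.+1)).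
  by rewrite ler_wpM2r ?exprn_ge0 ?(ltW r0) // lerXn2r ?nnegrE // mulr_ge0 ?expR_ge0 ?invr_ge0 ?ltW.
rewrite exprMn exprVn -mulrA ler_pM2l ?invr_gt0 ?exprn_gt0 //.
rewrite rE -!expRM_natl -expRD ler_expR -/x le_eqVlt; apply/orP; left; apply/eqP.
by ring.
Qed.

(** The law of x is explicit: it is a binomial probability, controlled by [binomial_window_le],
    times a factor at most 1 / (1 - c). *)
Lemma block_mean_pow4 (c : R) : 0 < c -> c < 1 ->
  exists C : R, forall n N : nat, (N.+2 <= n)%N -> N.+1%:R <= c * n.+1%:R ->
    block_mean n N (fun x _ => x ^+ 4) <= C.
Proof.
move=> c0 c1.
have r0 : 0 < c * expR (1 - c) by rewrite mulr_gt0 ?expR_gt0.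
have [C hC] := sum_pow4_geometric r0 (lt1_chernoff c0 c1).
(* The factor 1 / (1 - c) bounds M / (M - x), as x <= N + 1 <= c M; the factor 1 / c turns c^(u + 1)
   into c^u. *)
exists ((c * (1 - c))^-1 * C) => n N Nn Nc.
rewrite (block_mean1 Nn (fun x _ => x ^+ 4)).
have k0 : 0 < (c * (1 - c))^-1 by rewrite invr_gt0 mulr_gt0 // subr_gt0.
apply: (@le_trans _ _ ((c * (1 - c))^-1 *
   \sum_(i < n) i.+1%:R ^+ 4 * (c * expR (1 - c)) ^+ i.+1)); last first.
  by rewrite ler_pM2l.
rewrite mulr_suml mulr_sumr; apply: ler_sum => u _.
have un := ltn_ord u; rewrite coefXnM; have [Nu|uN] := ltnP N u.
  rewrite mulr0 !mul0r; rewrite !mulr_ge0 ?exprn_ge0 ?ler0n ?(ltW r0) ?(ltW k0) //.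
rewrite [leLHS]mulrAC [leLHS]mulrC [leRHS]mulrCA ler_wpM2l ?exprn_ge0 ?ler0n //.
rewrite !coef_park_poly; try lia.
have -> : (n - u.+1).+1 = (n - u)%N by lia.
set M : R := n.+1%:R; set x : R := u.+1%:R; set w : R := (n - u)%:R.
have M0 : 0 < M by rewrite ltr0n.
have w0 : 0 < w by rewrite ltr0n; lia.
have x1 : 1 <= x by rewrite ler1n.
have MN : 0 < M - N%:R by rewrite subr_gt0 ltr_nat; lia.
have wE : w = M - x by rewrite /w /M /x natrB -?natr1 -?natr1; [ring|lia].
(* The probability that exactly u of N independent uniform cars fall in a window of x out of M = x +
   w spots. *)
pose B : R := 'C(N, u)%:R * x ^+ u * w ^+ (N - u) / M ^+ N.
have fN : (N`!%:R : R) = 'C(N, u)%:R * (u`!%:R * (N - u)`!%:R).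
  by rewrite -!natrM bin_fact.
have -> : (x - u%:R) * x ^+ u / x / u`!%:R *
   ((w - (N - u)%:R) * w ^+ (N - u) / w / (N - u)`!%:R) /
   ((M - N%:R) * M ^+ N / M / N`!%:R) =
   B * ((M - N%:R - 1) / (M - N%:R) * (x^-1 * (M / w))).
  have -> : x - u%:R = 1 by rewrite /x -natr1; ring.
  have -> : w - (N - u)%:R = M - N%:R - 1 by rewrite wE natrB // /x -natr1; ring.
  rewrite fN /B; field.
  by rewrite !nat1r !gt_eqF ?exprn_gt0 ?ltr0n ?fact_gt0 ?bin_gt0 ?subn_gt0.
have Bge0 : 0 <= B by rewrite !mulr_ge0 ?invr_ge0 ?exprn_ge0 ?ler0n ?ltW.
apply: (@le_trans _ _ (B * (1 - c)^-1)).
  rewrite ler_wpM2l // -[leRHS]mul1r.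
  rewrite ler_pM ?mulr_ge0 ?invr_ge0 ?(ltW MN) ?(ltW M0) ?(ltW w0) ?(le_trans ler01 x1) //.
  - by rewrite -addrA -opprD natr1 subr_ge0 ler_nat; lia.
  - by rewrite ler_pdivrMr // mul1r gerBl.
  rewrite -[leRHS]mul1r ler_pM ?invr_ge0 ?mulr_ge0 ?invr_ge0 ?(ltW M0) ?(ltW w0)
    ?(le_trans ler01 x1) //.
    by rewrite invf_le1 // (lt_le_trans ltr01).
  rewrite ler_pdivrMr // ler_pdivlMl ?subr_gt0 // wE.
  have : x <= N.+1%:R by rewrite ler_nat.
  move: Nc; rewrite -/M; lra.
rewrite invfM mulrC -mulrA mulrCA ler_wpM2l ?invr_ge0 ?subr_ge0 ?(ltW c1) //.
have := binomial_window_le c0 c1 uN (ltnW un) (le_trans _ Nc).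
rewrite ler_nat leqnSn => /(_ isT) /le_trans; apply.
rewrite le_eqVlt; apply/orP; left; apply/eqP.
by rewrite exprMn [c ^+ u.+1]exprS; field; rewrite gt_eqF.
Qed.

End Tail.

(** * Moments of the first two preferences *)

Section Moments.
Variable R : realType.
Implicit Types n N : nat.


(** The quotient of [sum_pref] for (f, g) by [sum_pref] for (1, 1); the denominator is the mean
    number of admissible pairs. *)
Lemma pref_meanE n N (f g : nat -> R) F : (N.+2 <= n)%N ->
  (forall u v, (u + v + 2 <= n)%N -> pair_sum n f g u v = F u.+1%:R v.+1%:R) ->
  pref_mean n N f g =
  block_mean n N F / (n.+1%:R ^+ 2 - 2 * n.+1%:R * mean_gap R n N).
Proof.
move=> Nn fgF; rewrite /pref_mean /= big_filter (sum_pref Nn fgF).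
have := @sum_pref R n N Nn _ _ (fun x d => (n.+1%:R - x) ^+ 2 - d ^+ 2) (pair_sum1 R Nn).
under eq_bigr => t _ do rewrite mulr1.
rewrite big_const_seq iter_addr_0 -size_filter => ->.
have NP : N`!%:R * (park_poly R n (fun=> 0%N) n)`_N != 0.
  by rewrite mulf_neq0 // gt_eqF ?park_poly_gt0 ?ltr0n ?fact_gt0 //; lia.
rewrite invfM mulrACA divff // mul1r; congr (_ / _).
rewrite (@eq_block_mean R n N Nn _ (fun x d => n.+1%:R ^+ 2 +
  (- (2 * n.+1%:R) * x + (x ^+ 2 + -1 * d ^+ 2)))); last by move=> u v _; ring.
rewrite !block_meanD block_mean_cst // !block_meanZ.
by rewrite (block_meanC _ _ (fun x _ => x ^+ 2)) block_mean_gap //; ring.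
Qed.

Section PairSumDev.
Variables (n u v : nat).
Hypothesis uvn : (u + v + 2 <= n)%N.

Lemma pair_sum_dev_dev : pair_sum n (dev R n) (dev R n) u v =
  dev_dev n.+1%:R u.+1%:R v.+1%:R.
Proof.
rewrite /pair_sum !tail_sum_dev /dev_dev; try lia.
by rewrite -!natr1 natrD; field.
Qed.

Lemma pair_sum_dev_one : pair_sum n (dev R n) (fun=> 1) u v =
  dev_one n.+1%:R u.+1%:R v.+1%:R.
Proof.
rewrite /pair_sum !tail_sum_dev ?tail_sum1 /dev_one; try lia.
by rewrite -!natr1 natrD; field.
Qed.

Lemma pair_sum_dev2_one : pair_sum n (fun j => dev R n j ^+ 2) (fun=> 1) u v =
  dev2_one n.+1%:R u.+1%:R v.+1%:R.
Proof.
rewrite /pair_sum !tail_sum_dev2 ?tail_sum1 /dev2_one /square_sum /=; try lia.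
by rewrite -!natr1 natrD; field.
Qed.

End PairSumDev.

Lemma pair_sumC n (f g : nat -> R) u v : pair_sum n f g u v = pair_sum n g f u v.
Proof. by rewrite /pair_sum; ring. Qed.

Lemma block_mean_dist (c : R) : 0 < c -> c < 1 -> exists2 C : R, 0 <= C &
  forall n N k, (N.+2 <= n)%N -> N.+1%:R <= c * n.+1%:R ->
  forall F G : R -> R -> R,
  (forall x d, 1 <= x -> 1 <= d ->
     `|F x d - G x d| <= 100 * (n.+1%:R ^+ k * (x + d) ^+ 4)) ->
  `|block_mean n N F - block_mean n N G| <= C * n.+1%:R ^+ k.
Proof.
move=> c0 c1; have [C hC] := block_mean_pow4 c0 c1.
(* Here 16 = 8 + 8: (x + d)^4 <= 8 (x^4 + d^4), and both fourth powers have mean at most C. *)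
exists (100 * (16 * Num.max 0 C)).
  by rewrite !mulr_ge0 ?ler0n // le_max lexx.
move=> n N k Nn Nc F G FG.
have -> : block_mean n N F - block_mean n N G =
    block_mean n N (fun x d => F x d + -1 * G x d).
  by rewrite block_meanD block_meanZ mulN1r.
apply: (@le_trans _ _ (block_mean n N (fun x d =>
   100 * (8 * n.+1%:R ^+ k) * (x ^+ 4 + d ^+ 4)))).
  apply: ler_norm_block_mean => // u v _; rewrite mulN1r.
  have x1 : 1 <= u.+1%:R :> R by rewrite ler1n.
  have d1 : 1 <= v.+1%:R :> R by rewrite ler1n.
  apply: le_trans (FG _ _ x1 d1) _.
  have M0 : 0 <= n.+1%:R ^+ k :> R by rewrite exprn_ge0 ?ler0n.
  have : (u.+1%:R + v.+1%:R) ^+ 4 <= 8 * (u.+1%:R ^+ 4 + v.+1%:R ^+ 4) :> R.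
    move: x1 d1; move: (u.+1%:R : R) (v.+1%:R : R) => x d x1 d1.
    rewrite -subr_ge0.
    have -> : 8 * (x ^+ 4 + d ^+ 4) - (x + d) ^+ 4 =
      (x - d) ^+ 2 * (7 * x ^+ 2 + 10 * (x * d) + 7 * d ^+ 2) by ring.
    have [x0 d0] : 0 <= x /\ 0 <= d by split; lra.
    by rewrite mulr_ge0 ?sqr_ge0 // !addr_ge0 ?mulr_ge0 ?sqr_ge0.
  move=> h; have := ler_wpM2l M0 h; lra.
rewrite block_meanZ block_meanD (block_meanC _ _ (fun x _ => x ^+ 4)).
have h : block_mean n N (fun x _ => x ^+ 4) <= Num.max 0 C.
  by rewrite le_max hC ?orbT.
have M0 : 0 <= n.+1%:R ^+ k :> R by rewrite exprn_ge0 ?ler0n.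
have := ler_wpM2l M0 h; lra.
Qed.

End Moments.

(** * Variance and covariance as averages of centered preferences *)

Section Covariance.
Variables (R : realType) (n N : nat).
Hypothesis Nn : (N.+2 <= n)%N.
Local Notation s := (PF_seq N.+2 n).
Local Notation avg X := ((\sum_(t <- s) X t) / (size s)%:R : R).

(** Covariance is invariant under translation. Equality is asked only on [s] because n - (n - a) = a
    needs a <= n. *)
Lemma covariance_unifPF (X Y X' Y' : (N.+2).-tuple nat -> R) (a b : R) :
  {in s, forall t, X t = a + X' t} -> {in s, forall t, Y t = b + Y' t} ->
  covariance (unifPF R N.+2 n) X Y =
  (avg (fun t => X' t * Y' t) - avg X' * avg Y')%:E.
Proof.
move=> XE YE; have s0 := size_PF_seq_gt0 R Nn.
have S0 : (size s)%:R != 0 :> R by rewrite pnatr_eq0 -lt0n.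
have avgE (Z Z' : (N.+2).-tuple nat -> R) e : {in s, forall t, Z t = e + Z' t} ->
    avg Z = e + avg Z'.
  move=> ZE; rewrite (eq_big_seq _ ZE) big_split /= big_const_seq iter_addr_0.
  by rewrite count_predT -[e *+ _]mulr_natr; field.
rewrite unlock !expectation_unifPF // [fine _]/= [fine (_ / _)%:E]/=; congr _%:E.
rewrite (avgE _ _ _ XE) (avgE _ _ _ YE); set x := avg X'; set y := avg Y'.
rewrite (eq_big_seq (fun t => X' t * Y' t + (- y * X' t + (- x * Y' t + x * y)))); last first.
  by move=> t ts; rewrite !fctE /= XE // YE //; ring.
rewrite !big_split /= -!mulr_sumr big_const_seq iter_addr_0 count_predT.
by rewrite -[_ ^-1 *+ _]mulr_natr /x /y; field.
Qed.

Lemma pref_dev (t : (N.+2).-tuple nat) i : t \in s -> (i < N.+2)%N ->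
  pref R N.+2 i t = (n%:R + 1) / 2 + dev R n (n - nth 0%N t i).
Proof.
rewrite mem_filter mem_words => /andP[_ /allP tn] iN.
have := tn (nth 0%N t i); rewrite mem_nth ?size_tuple // => /(_ isT) /andP[_ tin].
by rewrite /pref /dev natrB //; field.
Qed.

Lemma pref_meanC (f g : nat -> R) (F : R -> R -> R) :
  (forall u v, (u + v + 2 <= n)%N -> pair_sum n f g u v = F u.+1%:R v.+1%:R) ->
  pref_mean n N f g = pref_mean n N g f.
Proof.
move=> fgF; rewrite (pref_meanE Nn fgF); apply/esym/(pref_meanE Nn) => u v uv.
by rewrite pair_sumC fgF.
Qed.

Lemma covariance_pref :
  covariance (unifPF R N.+2 n) (pref R N.+2 0) (pref R N.+2 1) =
  (pref_mean n N (dev R n) (dev R n) - pref_mean n N (dev R n) (fun=> 1) ^+ 2)%:E.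
Proof.
rewrite (covariance_unifPF (fun t ts => pref_dev ts (isT : (0 < N.+2)%N))
  (fun t ts => pref_dev ts (isT : (1 < N.+2)%N))).
congr (_ - _)%:E; rewrite expr2; congr (_ * _).
  by rewrite /pref_mean /=; under [in RHS]eq_bigr do rewrite mulr1.
rewrite (pref_meanC (@pair_sum_dev_one R n)).
by rewrite /pref_mean /=; under [in RHS]eq_bigr do rewrite mul1r.
Qed.

Lemma variance_pref :
  ('V_(unifPF R N.+2 n)[pref R N.+2 0] =
  (pref_mean n N (fun j => dev R n j ^+ 2) (fun=> 1)
   - pref_mean n N (dev R n) (fun=> 1) ^+ 2)%:E)%E.
Proof.
rewrite /variance (covariance_unifPF (fun t ts => pref_dev ts (isT : (0 < N.+2)%N))
  (fun t ts => pref_dev ts (isT : (0 < N.+2)%N))).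
congr (_ - _)%:E; rewrite ?expr2.
  by rewrite /pref_mean /=; under [in RHS]eq_bigr do rewrite mulr1.
by congr (_ * _); rewrite /pref_mean /=; under [in RHS]eq_bigr do rewrite mulr1.
Qed.

End Covariance.

(** * Asymptotics *)

Section Leading.
Variables (R : realType) (n N : nat).
Hypothesis Nn : (N.+2 <= n)%N.
Local Notation M := (n.+1%:R : R).
Local Notation mu := (mean_gap R n N).
Local Notation mean := (@block_mean R n N).

Lemma block_mean_dev_dev_lead :
  mean (fun x d => M ^+ 2 / 4 * ((x - 1) ^+ 2 - d ^+ 2)) = M ^+ 2 / 4 * (1 - 2 * mu).
Proof.
rewrite block_meanZ; congr (_ * _).
rewrite (@eq_block_mean R n N Nn _ (fun x d => 1 + (- 2 * x + (x ^+ 2 + -1 * d ^+ 2))));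
  last by move=> u v _; ring.
rewrite !block_meanD block_mean_cst // !block_meanZ.
by rewrite (block_meanC _ _ (fun x _ => x ^+ 2)) block_mean_gap //; ring.
Qed.

Lemma block_mean_dev_one_lead :
  mean (fun x _ => - (M ^+ 2 / 2 * (x - 1))) = - (M ^+ 2 / 2 * (mu - 1)).
Proof.
rewrite (@eq_block_mean R n N Nn _ (fun x _ => M ^+ 2 / 2 + - (M ^+ 2 / 2) * x));
  last by move=> u v _; ring.
by rewrite block_meanD block_mean_cst // block_meanZ block_mean_gap //; ring.
Qed.

Lemma block_mean_dev2_one_lead :
  mean (fun x _ => M ^+ 4 / 12 - M ^+ 3 / 3 * x) = M ^+ 4 / 12 - M ^+ 3 / 3 * mu.
Proof.
rewrite (@eq_block_mean R n N Nn _ (fun x _ => M ^+ 4 / 12 + - (M ^+ 3 / 3) * x));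
  last by move=> u v _; ring.
by rewrite block_meanD block_mean_cst // block_meanZ block_mean_gap //; ring.
Qed.

End Leading.

Section Asymptotics.
Variables (R : realType) (c : R).
Hypotheses (c0 : 0 < c) (c1 : c < 1).

(** One C serves all n and N. The remainders, of order M, M and M^2, are divided by M^2, M^2 and
    M^3, hence are O(t); the division by t in the last moment restores its order t^(-2). *)
Lemma pref_mean_asymp : exists2 C : R, 0 <= C &
  forall n N, (N.+2 <= n)%N -> N.+1%:R <= c * n.+1%:R ->
  let t : R := n.+1%:R^-1 in let mu : R := mean_gap R n N in
  exists e : R * R * R,
  [/\ `|e.1.1| <= C * t, `|e.1.2| <= C * t & `|e.2| <= C * t] /\
  [/\ pref_mean n N (dev R n) (dev R n) = ((1 - 2 * mu) / 4 + e.1.1) / (1 - 2 * t * mu),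
      pref_mean n N (dev R n) (fun=> 1) = (e.1.2 - (mu - 1) / 2) / (1 - 2 * t * mu) &
      pref_mean n N (fun j => dev R n j ^+ 2) (fun=> 1) =
        ((t^-1 / 12 - mu / 3) + e.2) / t / (1 - 2 * t * mu)].
Proof.
have [C C0 hC] := block_mean_dist c0 c1.
exists C => // n N Nn Nc t mu; set M : R := n.+1%:R.
have M1 : 1 <= M by rewrite ler1n.
have M0 : M != 0 by rewrite pnatr_eq0.
have M0' : 0 < M by rewrite ltr0n.
have h1 := hC n N 1%N Nn Nc (dev_dev M) _ (fun x d => @dev_dev_bound R M x d M1).
have h2 : `|block_mean n N (dev_one M) + M ^+ 2 / 2 * (mu - 1)| <= C * M ^+ 1.
  have := hC n N 1%N Nn Nc (dev_one M) (fun x _ => - (M ^+ 2 / 2 * (x - 1))).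
  rewrite block_mean_dev_one_lead // opprK; apply => x d x1 d1.
  by rewrite opprK; exact: dev_one_bound.
have h3 := hC n N 2%N Nn Nc (dev2_one M) _ (fun x d => @dev2_one_bound R M x d M1).
rewrite block_mean_dev_dev_lead // in h1.
rewrite block_mean_dev2_one_lead // in h3.
set B1 := block_mean n N (dev_dev M) in h1.
set B2 := block_mean n N (dev_one M) in h2.
set B3 := block_mean n N (dev2_one M) in h3.
exists ((B1 - M ^+ 2 / 4 * (1 - 2 * mu)) / M ^+ 2,
  (B2 + M ^+ 2 / 2 * (mu - 1)) / M ^+ 2,
  (B3 - (M ^+ 4 / 12 - M ^+ 3 / 3 * mu)) / M ^+ 3) => /=.
have tE : t = M^-1 by [].
have DE : M ^+ 2 - 2 * M * mu = M ^+ 2 * (1 - 2 * t * mu) by rewrite tE; field.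
split; split.
- rewrite normrM normfV (gtr0_norm (exprn_gt0 _ M0')) ler_pdivrMr ?exprn_gt0 //.
  by apply: le_trans h1 _; rewrite tE le_eqVlt; apply/orP; left; apply/eqP; field.
- rewrite normrM normfV (gtr0_norm (exprn_gt0 _ M0')) ler_pdivrMr ?exprn_gt0 //.
  by apply: le_trans h2 _; rewrite tE le_eqVlt; apply/orP; left; apply/eqP; field.
- rewrite normrM normfV (gtr0_norm (exprn_gt0 _ M0')) ler_pdivrMr ?exprn_gt0 //.
  by apply: le_trans h3 _; rewrite tE le_eqVlt; apply/orP; left; apply/eqP; field.
- rewrite (pref_meanE Nn (@pair_sum_dev_dev R n)) -/M -/mu DE invfM mulrA.
  by congr (_ / _); rewrite -/B1; field.
- rewrite (pref_meanE Nn (@pair_sum_dev_one R n)) -/M -/mu DE invfM mulrA.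
  by congr (_ / _); rewrite -/B2; field.
- rewrite (pref_meanE Nn (@pair_sum_dev2_one R n)) -/M -/mu DE invfM mulrA.
  by congr (_ / _); rewrite -/B3 tE; field.
Qed.

(** With N = c n - 2 and M = n + 1, M - N = (1 - c) M + c + 2. *)
Lemma mean_gapE n N : (N.+2)%:R = c * n%:R ->
  mean_gap R n N = (1 - c + (c + 2) * n.+1%:R^-1)^-1.
Proof.
move=> Nc; have M0 : n.+1%:R != 0 :> R by rewrite pnatr_eq0.
rewrite /mean_gap -[LHS]invrK invf_div; congr (_^-1).
have -> : N%:R = c * n%:R - 2 :> R by rewrite -Nc -addn2 natrD addrK.
by move: M0; rewrite -!natr1 => M0; field.
Qed.

End Asymptotics.

(** * Limits of the explicit expressions as t tends to 0 *)

Section Limits.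
Variables (R : realType) (T : Type) (F : set_system T) (FF : Filter F).
Variables (c C : R) (t e1 e2 e3 : T -> R).
Hypotheses (c1 : c < 1) (t0 : t @ F --> 0).
Hypotheses (he1 : \forall n \near F, `|e1 n| <= C * t n)
  (he2 : \forall n \near F, `|e2 n| <= C * t n)
  (he3 : \forall n \near F, `|e3 n| <= C * t n).
Local Notation mu n := (1 - c + (c + 2) * t n)^-1.
Local Notation den n := (1 - 2 * t n * mu n).

Lemma cvg0_le (e : T -> R) : (\forall n \near F, `|e n| <= C * t n) -> e @ F --> (0 : R).
Proof.
move=> he; have Ct : (fun n => C * t n) @ F --> (0 : R).
  by rewrite -[X in _ --> X](mulr0 C); apply: cvgM => //; exact: cvg_cst.
apply: (squeeze_cvgr _ _ Ct); last first.
  by rewrite -oppr0; exact: cvgN Ct.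
by near=> n; rewrite -ler_norml; near: n.
Unshelve. all: by end_near. Qed.

Let mu_cvg : (fun n => mu n) @ F --> (1 - c)^-1.
Proof.
have : (fun n => 1 - c + (c + 2) * t n) @ F --> 1 - c + (c + 2) * 0.
  by apply: cvgD; [exact: cvg_cst | apply: cvgM => //; exact: cvg_cst].
by rewrite mulr0 addr0; apply: cvgV; rewrite subr_eq0 gt_eqF.
Qed.

Let den_cvg : (fun n => den n) @ F --> (1 : R).
Proof.
have : (fun n => den n) @ F --> 1 - 2 * 0 * (1 - c)^-1.
  apply: cvgB; first exact: cvg_cst.
  by apply: cvgM => //; apply: cvgM => //; exact: cvg_cst.
by rewrite mulr0 mul0r subr0.
Qed.

Let over_den_cvg (f : T -> R) (l : R) : f @ F --> l -> (fun n => f n / den n) @ F --> l.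
Proof.
move=> fl; rewrite -[l]divr1; apply: cvgM => //.
by apply: cvgV => //; rewrite oner_eq0.
Qed.

Lemma cov_cvg :
  (fun n => ((1 - 2 * mu n) / 4 + e1 n) / den n - ((e2 n - (mu n - 1) / 2) / den n) ^+ 2)
    @ F --> - (4 * (1 - c) ^+ 2)^-1.
Proof.
have c1' : 1 - c != 0 by rewrite subr_eq0 gt_eqF.
(* The value at t = 0, where mu = 1 / (1 - c) and the errors vanish; it equals - mu^2 / 4. *)
have -> : - (4 * (1 - c) ^+ 2)^-1 = ((1 - 2 * (1 - c)^-1) / 4 + 0)
    - (0 - ((1 - c)^-1 - 1) / 2) * (0 - ((1 - c)^-1 - 1) / 2) :> R by field.
have h2 : (fun n => (e2 n - (mu n - 1) / 2) / den n) @ F --> 0 - ((1 - c)^-1 - 1) / 2.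
  apply: over_den_cvg; apply: cvgB; first exact: cvg0_le.
  by apply: cvgM; [apply: cvgB => // |]; exact: cvg_cst.
apply: cvgB; last exact: cvgM.
apply: over_den_cvg; apply: cvgD; last exact: cvg0_le.
apply: cvgM; last exact: cvg_cst.
by apply: cvgB; [exact: cvg_cst|apply: cvgM => //; exact: cvg_cst].
Qed.

(** With n = 1/t - 1, this is t times the variance minus its claimed expansion. The terms 1 / (12 t)
    cancel: n^2 / 12 leaves 1/6 - t/12, and 1 / den - 1 = 2 t mu / den turns - mu / 3 into - mu /
    6. *)
Lemma var_cvg :
  (fun n => (e3 n - mu n / 6) / den n - t n * ((e2 n - (mu n - 1) / 2) / den n) ^+ 2
     + 6^-1 - t n / 12 + c / (6 * (1 - c)) * (1 - t n)) @ F --> (0 : R).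
Proof.
have c1' : 1 - c != 0 by rewrite subr_eq0 gt_eqF.
have h2 : (fun n => (e2 n - (mu n - 1) / 2) / den n) @ F --> 0 - ((1 - c)^-1 - 1) / 2.
  apply: over_den_cvg; apply: cvgB; first exact: cvg0_le.
  by apply: cvgM; [apply: cvgB => // |]; exact: cvg_cst.
pose l : R := 0 - ((1 - c)^-1 - 1) / 2.
have -> : 0 = (0 - (1 - c)^-1 / 6) - 0 * (l * l) + 6^-1 - 0 / 12 +
   c / (6 * (1 - c)) * (1 - 0) :> R by rewrite /l; field.
apply: cvgD; last first.
  by apply: cvgM; [exact: cvg_cst | apply: cvgB => //; exact: cvg_cst].
apply: cvgB; last by apply: cvgM => //; exact: cvg_cst.
apply: cvgD; last exact: cvg_cst.
apply: cvgB; last by apply: cvgM => //; exact: cvgM.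
apply: over_den_cvg; apply: cvgB; first exact: cvg0_le.
by apply: cvgM => //; exact: cvg_cst.
Qed.

End Limits.

Theorem proposition3p5 (R : realType) (c : R) (m : nat -> nat) :
  let F := within [set n : nat | c * n%:R \is a Num.int] \oo in
  0 < c -> c < 1 ->
  (forall n : nat, c * n%:R \is a Num.int -> (m n)%:R = c * n%:R) ->
  ((fun n : nat => fine 'V_(unifPF R (m n) n)[pref R (m n) 0%N] : R^o) =
    (fun n : nat => 12%:R^-1 * n%:R ^+ 2 - c / (6%:R * (1 - c)) * n%:R : R^o)
    +o_F (fun n : nat => n%:R : R^o))
  /\
  covariance (unifPF R (m n) n) (pref R (m n) 0%N) (pref R (m n) 1%N)
    @[n --> F]
    --> (- (4%:R * (1 - c) ^+ 2)^-1)%:E.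
Proof.
(* For irrational c no n > 0 qualifies and the filter is improper, so only [Filter] is available. *)
move=> F c0 c1 hm; have FF : Filter F by exact: within_filter.
have [C C0 hC] := pref_mean_asymp c0 c1.
pose N n := (m n - 2)%N.
pose t n : R := n.+1%:R^-1.
pose mu n := (1 - c + (c + 2) * t n)^-1.
pose den n := 1 - 2 * t n * mu n.
pose good n := m n = (N n).+2 /\ ((N n).+2 <= n)%N.
(* Beyond 2 / c, m n exceeds 2, so the subtraction in [N] is not truncated. *)
have near_good : \forall n \near F, good n /\ (m n)%:R = c * n%:R.
  apply: filterS (nbhs_infty_gtr (2 / c)) => n hn /hm mE; split=> //.
  have m2 : (2 < m n)%N by rewrite -(ltr_nat R) mE mulrC -ltr_pdivrMr.
  have mn : (m n <= n)%N by rewrite -(ler_nat R) mE ler_piMl ?ler0n // ltW.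
  by rewrite /good /N; split; lia.
have t0 : t @ F --> (0 : R) by apply: cvg_within_filter; exact: cvg_harmonic.
have /choice[e he] : forall n, exists e : R * R * R, good n -> (m n)%:R = c * n%:R ->
  [/\ `|e.1.1| <= C * t n, `|e.1.2| <= C * t n & `|e.2| <= C * t n] /\
  [/\ pref_mean n (N n) (dev R n) (dev R n) = ((1 - 2 * mu n) / 4 + e.1.1) / den n,
      pref_mean n (N n) (dev R n) (fun=> 1) = (e.1.2 - (mu n - 1) / 2) / den n &
      pref_mean n (N n) (fun j => dev R n j ^+ 2) (fun=> 1) =
        (((t n)^-1 / 12 - mu n / 3) + e.2) / t n / den n].
  move=> n; have [[gn cn]|ngn] := pselect (good n /\ (m n)%:R = c * n%:R); last first.
    by exists (0, 0, 0) => gn cn; case: ngn.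
  case: (gn) => mE Nn; rewrite mE in cn.
  have Nc : (N n).+1%:R <= c * n.+1%:R.
    by move: cn; rewrite -!natr1; move: c0; lra.
  have [e] := hC n (N n) Nn Nc; rewrite (mean_gapE cn) => he.
  by exists e.
have he1 : \forall n \near F, `|(e n).1.1| <= C * t n.
  by apply: filterS near_good => n [gn cn]; case: (he n gn cn) => -[].
have he2 : \forall n \near F, `|(e n).1.2| <= C * t n.
  by apply: filterS near_good => n [gn cn]; case: (he n gn cn) => -[].
have he3 : \forall n \near F, `|(e n).2| <= C * t n.
  by apply: filterS near_good => n [gn cn]; case: (he n gn cn) => -[].
split; last first.
  have covE : \forall n \near F,
      covariance (unifPF R (m n) n) (pref R (m n) 0%N) (pref R (m n) 1%N) =
      (((1 - 2 * mu n) / 4 + (e n).1.1) / den n -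
       (((e n).1.2 - (mu n - 1) / 2) / den n) ^+ 2)%:E.
    apply: filterS near_good => n [gn cn]; have [_ [h1 h2 _]] := he n gn cn.
    by case: gn => -> Nn; rewrite covariance_pref // h1 h2.
  apply/fine_cvgP; split; first by apply: filterS covE => n ->.
  apply: cvg_trans (cov_cvg FF c1 t0 he1 he2).
  by apply: near_eq_cvg; apply: filterS covE => n /= ->.
apply/eqaddoP => eps eps0.
(* Half of eps, because the factor 1 / t = n + 1 is at most 2 n for n > 0. *)
have h := @cvgr0_norm_le _ _ _ _ FF _ (var_cvg FF c1 t0 he2 he3) _ (divr_gt0 eps0 (ltr0n R 2)).
have n1 : \forall n \near F, (0 < n)%N by apply: cvg_within; exact: nbhs_infty_gt.
apply: filterS3 near_good h n1 => n [gn cn] h n0.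
have [_ [_ h1 h2]] := he n gn cn.
case: gn => mE Nn; rewrite !fctE.
rewrite mE variance_pref // h1 h2 [fine _]/=.
have t_gt0 : 0 < t n by rewrite invr_gt0 ltr0n.
have q_gt0 : 0 < 1 - c + (c + 2) * t n by rewrite addr_gt0 ?subr_gt0 // mulr_gt0 // addr_gt0.
have den0 : den n != 0.
  have -> : den n = (1 - c + c * t n) / (1 - c + (c + 2) * t n).
    by rewrite /den /mu; field; rewrite gt_eqF.
  by rewrite gt_eqF // divr_gt0 // addr_gt0 ?subr_gt0 ?mulr_gt0.
rewrite -/(mu n) -/(den n) in h.
set A := (((e n).1.2 - (mu n - 1) / 2) / den n) in h *.
have nE : n%:R = (t n)^-1 - 1 :> R by rewrite invrK -natr1; ring.
have c1' : 1 - c != 0 by rewrite subr_eq0 gt_eqF.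
rewrite [X in `|X|](_ : _ = (t n)^-1 * ((((e n).2 - mu n / 6) / den n - t n * A ^+ 2 +
    6^-1 - t n / 12 + c / (6 * (1 - c)) * (1 - t n)))); last first.
  rewrite nE; move: A {h h1 h2} den0; rewrite /den; move: (mu n) => mu' A den0.
  by field; rewrite c1' den0 gt_eqF.
rewrite normrM gtr0_norm ?invr_gt0 // normr_nat [(t n)^-1]invrK.
apply: le_trans (ler_wpM2l (ler0n _ _) h) _.
rewrite mulrCA ler_pM2l // ler_pdivrMr // -natrM ler_nat; lia.
Qed.
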